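(* Let $\lambda,\mu\in\mathbb{C}\setminus\mathbb{N}_0$, $l\in\mathbb{N}_0$, and let $$d\tilde\pi(X)=t(t+1)\partial_t^2+\big(t(\mu-2(l-1))-\lambda\big)\partial_t+l(l-1-\mu),$$ $$d\tilde\pi(F)=-t(t-1)\partial_t^2+\big(t(2l-\mu-2)-\lambda\big)\partial_t+l(\mu-l+1)$$ be the differential operators acting on polynomials of degree $l$ in the variable $t$. Let $P_l^{\alpha,\beta}(x)$ be the Jacobi polynomial of degree $l$, and, with $x=2t+1$, $$d\tilde\pi(X)\big(P_l^{-\lambda-1,\,\mu+\lambda-2l+1}(2t+1)\big)=0.$$ Then $$d\tilde\pi(F)\big(P_l^{-\lambda-1,\,\mu+\lambda-2l+1}(2t+1)\big)=2(l-1-\lambda)(\mu-l+1)\,P_{l-1}^{-\lambda-1,\,\mu+\lambda-2l+3}(2t+1),$$ i.e. $d\tilde\pi(F)$ maps the homogeneity $l$ polynomial solution of the Jacobi differential equation $d\tilde\pi(X)$ to a multiple of the homogeneity $(l-1)$ polynomial solution of the Jacobi differential equation (the one with $l$ replaced by $l-1$). Here $P_{-1}^{\alpha,\beta}:=0$.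
   Context: $\mathbb{N}_0=\{0,1,2,\dots\}$. For $l\in\mathbb{N}_0$, $\alpha,\beta\in\mathbb{C}$, the Jacobi polynomial is $$P_l^{\alpha,\beta}(z)=\sum_{j=0}^l\binom{l+\alpha}{j}\binom{l+\beta}{l-j}\Big(\frac{z-1}{2}\Big)^{l-j}\Big(\frac{z+1}{2}\Big)^j,\qquad \binom{a}{j}=\frac{a(a-1)\cdots(a-j+1)}{j!},$$ normalized by $P_l^{\alpha,\beta}(1)=\binom{l+\alpha}{l}$; it satisfies $\big((1-x^2)\frac{d^2}{dx^2}+(\beta-\alpha-(\alpha+\beta+2)x)\frac{d}{dx}+l(l+\alpha+\beta+1)\big)P_l^{\alpha,\beta}(x)=0$. Origin of the operators: for $\mathfrak g=\mathfrak{sl}(2,\mathbb{R})\times\mathfrak{sl}(2,\mathbb{R})$ with diagonal subalgebra $\mathfrak g'$, the Verma module with parameters $(\lambda,\mu)$ is realized on $\mathbb{C}[\xi,\eta]$; the generator $X$ of the nilradical of the Borel subalgebra of $\mathfrak g'$ acts by $i(-\lambda\partial_\xi+\xi\partial_\xi^2-\mu\partial_\eta+\eta\partial_\eta^2)$, and the generator $F$ of its complement in the nilradical of the Borel subalgebra of $\mathfrak g$ acts by $i(-\lambda\partial_\xi+\xi\partial_\xi^2+\mu\partial_\eta-\eta\partial_\eta^2)$. The operators $d\tilde\pi(X)$ and $d\tilde\pi(F)$ in the claim are the corresponding operators in the variable $t=\xi/\eta$ on homogeneous polynomials $\eta^lQ(t)$ of degree $l$. *)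

(* Defs.v *)
From mathcomp Require Import all_boot all_order all_algebra.
From mathcomp Require Import reals complex.

Set Implicit Arguments.
Unset Strict Implicit.
Unset Printing Implicit Defensive.

Import Order.TTheory GRing.Theory Num.Theory.
Local Open Scope ring_scope.

Section Jacobi.
Variable K : numFieldType.

Definition gbinom (a : K) (j : nat) : K :=
  (\prod_(i < j) (a - i%:R)) / (j`!)%:R.

(* The degree index is an integer so that P_(-1) = 0 makes sense. *)
Definition jacobi (n : int) (a b : K) : {poly K} :=
  match n with
  | Posz l =>
      \sum_(j < l.+1)
        (gbinom (l%:R + a) j * gbinom (l%:R + b) (l - j)) *:
          ((2^-1 *: ('X - 1)) ^+ (l - j) * (2^-1 *: ('X + 1)) ^+ j)
  | Negz _ => 0
  end.

(* The indeterminate of the polynomials below is t; d/dt is the formal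
   derivative. *)
Definition dpiX (l : int) (lam mu : K) (Q : {poly K}) : {poly K} :=
  'X * ('X + 1) * Q^`(2)
  + ((mu - 2 * (l%:~R - 1)) *: 'X - lam%:P) * Q^`()
  + (l%:~R * (l%:~R - 1 - mu)) *: Q.

Definition dpiF (l : int) (lam mu : K) (Q : {poly K}) : {poly K} :=
  - ('X * ('X - 1)) * Q^`(2)
  + ((2 * l%:~R - mu - 2) *: 'X - lam%:P) * Q^`()
  + (l%:~R * (mu - l%:~R + 1)) *: Q.

End Jacobi.

(* Main.v *)
(* With u = t and v = t + 1, the polynomial P is the sum over j of
   p_j u^(l-j) v^j with p_j = C(l-1-lam, j) C(mu+lam-l+1, l-j).  Since v - u = 1,
   d~pi(X) can be written with coefficients homogeneous in (u, v), so it acts on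
   the basis u^(l-j) v^j by a tridiagonal matrix, and the two-term recurrence
   satisfied by p_j kills the sum.  For the second claim,
   d~pi(X) + d~pi(F) = 2 (t d^2 - lam d), which lowers the degree in (u, v) by
   one; the coefficients are compared with the Pascal rule. *)
Require Import Defs.
From mathcomp Require Import all_boot all_order all_algebra.
From mathcomp Require Import reals complex ring.

Import Order.TTheory GRing.Theory Num.Theory.
Local Open Scope ring_scope.
Local Open Scope complex_scope.

Section JacobiShift.
Variable K : numFieldType.
Implicit Types (a b lam mu : K) (m n l j : nat) (Q : {poly K}).

Lemma gbinom0 a : gbinom a 0 = 1.
Proof. by rewrite /gbinom big_ord0 fact0 divr1. Qed.

Lemma gbinomS a n : n.+1%:R * gbinom a n.+1 = (a - n%:R) * gbinom a n.
Proof.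
rewrite /gbinom big_ord_recr /= factS natrM.
have n1 : n.+1%:R != 0 :> K by rewrite pnatr_eq0.
have nf : (n`!)%:R != 0 :> K by rewrite pnatr_eq0 -lt0n fact_gt0.
move: (\prod_(i < n) _) (n.+1%:R) (n`!%:R) n1 nf => p x y n1 nf.
by field; rewrite n1 nf.
Qed.

Lemma gbinom_absorb a n : n.+1%:R * gbinom a n.+1 = a * gbinom (a - 1) n.
Proof.
elim: n => [|n IH]; first by rewrite gbinomS !gbinom0 subr0.
apply: (@mulfI _ n.+1%:R); first by rewrite pnatr_eq0.
rewrite gbinomS mulrCA IH [RHS]mulrCA gbinomS.
by rewrite -[n.+1]addn1 natrD; ring.
Qed.

Lemma gbinom_pascal a n : gbinom (a + 1) n.+1 = gbinom a n.+1 + gbinom a n.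
Proof.
apply: (@mulfI _ n.+1%:R); first by rewrite pnatr_eq0.
by rewrite mulrDr gbinom_absorb gbinomS addrK -[n.+1]addn1 natrD; ring.
Qed.

Definition mono m n : {poly K} := 'X ^+ m * ('X + 1) ^+ n.

(** The parameters are the upper binomial entries [l + alpha] and [l + beta], not the Jacobi
    parameters. The factors [2^-1] disappear because [(x - 1) / 2 = t] and [(x + 1) / 2 = t + 1] at
    [x = 2t + 1]. *)
Definition jacobi_shift l a b : {poly K} :=
  \sum_(j < l.+1) (gbinom a j * gbinom b (l - j)) *: mono (l - j) j.

Lemma jacobi_comp l a b :
  jacobi l%:Z a b \Po (2 *: 'X + 1) = jacobi_shift l (l%:R + a) (l%:R + b).
Proof.
have two : (2^-1)%:P * 2%:P = 1 :> {poly K}.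
  by rewrite -polyCM mulVf // pnatr_eq0.
rewrite /jacobi /jacobi_shift [LHS]rmorph_sum; apply: eq_bigr => j _ /=.
rewrite comp_polyZ rmorphM !rmorphXn /= !comp_polyZ; congr (_ *: (_ ^+ _ * _ ^+ _)).
  by rewrite rmorphB rmorph1 /= comp_polyX addrK scalerA mulVf ?scale1r ?pnatr_eq0.
rewrite rmorphD rmorph1 /= comp_polyX -!mul_polyC.
transitivity ((2^-1)%:P * 2%:P * ('X + 1) : {poly K}); last by rewrite two mul1r.
by ring.
Qed.

Lemma deriv_mono m n :
  (mono m n)^`() = m%:R *: mono m.-1 n + n%:R *: mono m n.-1.
Proof.
rewrite /mono derivM derivXn deriv_exp derivD derivX derivC.
by rewrite addr0 mul1r !scaler_nat -mulrnAl -mulrnAr.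
Qed.

(** Writing [lam] as [lam (v - u)] turns the first-order coefficient into
    [(mu + lam - 2 (l - 1)) u - lam v] with [l = m + n]. A truncated predecessor only occurs with a
    vanishing coefficient. *)
Lemma dpiX_mono lam mu m n :
  dpiX (m + n)%:Z lam mu (mono m n) =
    (m%:R * (m%:R - 1 - lam)) *: mono m.-1 n.+1
    + (2 * n%:R * m%:R + (mu + lam - 2 * ((m + n)%:R - 1)) * m%:R - lam * n%:R
       + (m + n)%:R * ((m + n)%:R - 1 - mu)) *: mono m n
    + (n%:R * (n%:R - 1 + (mu + lam - 2 * ((m + n)%:R - 1)))) *: mono m.+1 n.-1.
Proof.
rewrite /dpiX derivnS derivn1 deriv_mono derivD !derivZ !deriv_mono -!mul_polyC -!pmulrn.
case: m => [|[|m]]; case: n => [|[|n]]; rewrite /mono /= ?expr0 ?expr1 ?exprS;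
  try move: (('X + 1) ^+ n) => q; try move: ('X ^+ m) => p; ring.
Qed.

Definition lower lam Q := 'X * Q^`(2) - lam *: Q^`().

Lemma dpiF_dpiX l lam mu Q :
  dpiF l%:Z lam mu Q = 2 *: lower lam Q - dpiX l%:Z lam mu Q.
Proof. by rewrite /dpiF /dpiX /lower -!mul_polyC -!pmulrn; ring. Qed.

Lemma lower_mono lam m n :
  lower lam (mono m n) =
    (m%:R * (m%:R - 1 - lam)) *: mono m.-1 n
    + (n%:R * (2 * m%:R - lam)) *: mono m n.-1
    + (n%:R * (n%:R - 1)) *: mono m.+1 n.-2.
Proof.
rewrite /lower derivnS derivn1 deriv_mono derivD !derivZ !deriv_mono -!mul_polyC.
case: m => [|[|m]]; case: n => [|[|n]]; rewrite /mono /= ?expr0 ?expr1 ?exprS;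
  try move: (('X + 1) ^+ n) => q; try move: ('X ^+ m) => p; ring.
Qed.

(** Two uses of [gbinomS]: for [b] at [l - j - 1] and for [a] at [j]. *)
Lemma coef_rec l a b j : (j < l)%N ->
  (gbinom a j * gbinom b (l - j)) * ((l - j)%:R * (a - j%:R)) =
  (gbinom a j.+1 * gbinom b (l - j.+1))
    * (j.+1%:R * (b - l%:R + j.+1%:R)).
Proof.
move=> jl; rewrite -{1 2}(subnSK jl).
set k := (l - j.+1)%N.
have -> : b - l%:R + j.+1%:R = b - k%:R by rewrite natrB //; ring.
transitivity ((k.+1%:R * gbinom b k.+1) * ((a - j%:R) * gbinom a j)); first by ring.
by rewrite gbinomS -[(a - j%:R) * _]gbinomS; ring.
Qed.

Lemma dpiX_linear l lam mu n (c : 'I_n -> K) (f : 'I_n -> {poly K}) :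
  dpiX l%:Z lam mu (\sum_j c j *: f j) = \sum_j c j *: dpiX l%:Z lam mu (f j).
Proof.
rewrite /dpiX derivnS derivn1 !(linear_sum deriv) scaler_sumr !mulr_sumr -!big_split /=.
by apply: eq_bigr => j _; rewrite !derivZ -!mul_polyC; ring.
Qed.

Lemma lower_linear lam n (c : 'I_n -> K) (f : 'I_n -> {poly K}) :
  lower lam (\sum_j c j *: f j) = \sum_j c j *: lower lam (f j).
Proof.
rewrite /lower derivnS derivn1 !(linear_sum deriv) scaler_sumr !mulr_sumr -sumrB /=.
by apply: eq_bigr => j _; rewrite !derivZ -!mul_polyC; ring.
Qed.

Lemma dpiX_jacobi_shift l lam mu :
  dpiX l%:Z lam mu (jacobi_shift l (l%:R - 1 - lam) (mu + lam - l%:R + 1)) = 0.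
Proof.
set a := l%:R - 1 - lam; set b := mu + lam - l%:R + 1.
pose p j := gbinom a j * gbinom b (l - j).
rewrite dpiX_linear.
(* [up] and [dn] are the off-diagonal contributions of index [j]; for these [a] and [b] the diagonal
   one is exactly [- (up j + dn j)]. *)
pose up j := p j * ((l - j)%:R * (a - j%:R)).
pose dn j := p j * (j%:R * (b - l%:R + j%:R)).
have updn j : (j < l)%N -> up j = dn j.+1 by exact: coef_rec.
transitivity (\sum_(j < l.+1) (up j *: mono (l - j).-1 j.+1
    - (up j + dn j) *: mono (l - j) j
    + dn j *: mono (l - j).+1 j.-1)).
  apply: eq_bigr => j _; have jl : (j <= l)%N by rewrite -ltnS.
  have -> : dpiX l%:Z lam mu = dpiX ((l - j) + j)%:Z lam mu by rewrite subnK.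
  rewrite dpiX_mono subnK // /up /dn -/(p j) !scalerDr !scalerA -scaleNr.
  by congr (_ *: _ + _ *: _ + _ *: _); rewrite /a /b ?natrB //; ring.
rewrite big_split /= sumrB.
under [X in _ - X + _]eq_bigr do rewrite scalerDl.
rewrite big_split /=.
(* Shifting the index loses nothing at the ends, since [up l = 0] and [dn 0 = 0]. *)
have -> : \sum_(j < l.+1) up j *: mono (l - j).-1 j.+1
        = \sum_(j < l.+1) dn j *: mono (l - j) j.
  rewrite big_ord_recr [RHS]big_ord_recl /= /up /dn subnn !(mul0r, mulr0) !scale0r.
  rewrite addr0 add0r; apply: eq_bigr => j _.
  by rewrite /bump /= add1n subnS -[in LHS]/(up j) updn.
have -> : \sum_(j < l.+1) dn j *: mono (l - j).+1 j.-1
        = \sum_(j < l.+1) up j *: mono (l - j) j.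
  rewrite [RHS]big_ord_recr big_ord_recl /= /up /dn subnn !(mul0r, mulr0) !scale0r.
  rewrite addr0 add0r; apply: eq_bigr => j _.
  by rewrite /bump /= add1n subnSK // -[in RHS]/(up j) updn.
by ring.
Qed.

(** Lowering the degree changes [(a, b)] to [(a - 1, b + 1)]: absorption accounts for the first
    shift and the Pascal rule for the second. *)
Lemma lower_jacobi_shift l lam mu :
  lower lam (jacobi_shift l.+1 (l.+1%:R - 1 - lam) (mu + lam - l.+1%:R + 1)) =
  ((l.+1%:R - 1 - lam) * (mu - l.+1%:R + 1)) *:
    jacobi_shift l (l%:R - 1 - lam) (mu + lam - l%:R + 1).
Proof.
set a := l.+1%:R - 1 - lam; set b := mu + lam - l.+1%:R + 1.
have -> : l%:R - 1 - lam = a - 1 by rewrite /a; ring.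
have -> : mu + lam - l%:R + 1 = b + 1 by rewrite /b; ring.
pose p j := gbinom a j * gbinom b (l.+1 - j).
have pS j : j.+1%:R * p j.+1 = a * (gbinom (a - 1) j * gbinom b (l - j)).
  by rewrite /p subSS mulrA gbinom_absorb; ring.
have pSS j : j.+1%:R * j.+2%:R * p j.+2
   = a * ((a - 1 - j%:R) * gbinom (a - 1) j * gbinom b (l - j.+1)).
  by rewrite -mulrA pS -gbinomS; ring.
rewrite lower_linear.
under eq_bigr do rewrite lower_mono !scalerDr !scalerA -/(p _).
rewrite !big_split /=.
(* Vanishing end terms are dropped: [j = l + 1] in the first sum, [j = 0] in the second, [j = 0, 1]
   in the third. After reindexing all three run over [mono (l - j) j], the third only for [j < l],
   so [j = l] is treated apart. *)
rewrite big_ord_recr /= subnn mul0r mulr0 scale0r addr0.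
rewrite [X in _ + X + _]big_ord_recl /= mul0r mulr0 scale0r add0r.
rewrite [X in _ + X]big_ord_recl /= mul0r mulr0 scale0r add0r.
rewrite [X in _ + X]big_ord_recl /= subrr mulr0 mulr0 scale0r add0r.
rewrite -big_split /= big_ord_recr /= addrAC -big_split /=.
rewrite /jacobi_shift big_ord_recr /= scalerDr scaler_sumr; congr (_ + _).
  apply: eq_bigr => j _; have jl := ltn_ord j.
  rewrite /bump /= !add1n !subSS.
  have -> : (l.+1 - j).-1 = (l - j)%N by rewrite subSn // ltnW.
  rewrite subnSK // -!scalerDl scalerA; congr (_ *: _).
  have lj : (l.+1 - j)%:R = l.+1%:R - j%:R :> K by rewrite (natrB _ (leqW (ltnW jl))).
  have eq_a : (l.+1 - j)%:R - 1 - lam = a - j%:R by rewrite lj /a; ring.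
  have top : p j.+2 * (j.+2%:R * (j.+2%:R - 1)) = j.+1%:R * j.+2%:R * p j.+2 by ring.
  (* All three contributions become multiples of [a * gbinom (a - 1) j]. What remains is linear in
     [H] and [G], and the two sides differ by a multiple of [gbinomS b k]. *)
  rewrite {}eq_a {}top (@coef_rec l.+1 a b j (leqW jl)) -/(p j.+1) pSS.
  rewrite [X in X + _ + _]mulrA [X in _ + X + _]mulrA [p _ * _]mulrC pS.
  have lk : l%:R = (l - j.+1)%:R + j%:R + 1 :> K by rewrite natrB //; ring.
  rewrite -(subnSK jl) gbinom_pascal.
  set k := (l - j.+1)%N in lk *; have := gbinomS b k.
  set H := gbinom b k.+1; set G := gbinom b k; set c := gbinom (a - 1) j => HG.
  have /eqP := HG; rewrite -subr_eq0 => /eqP HG0.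
  apply/eqP; rewrite -subr_eq0; apply/eqP.
  transitivity (a * c * (k.+1%:R * H - (b - k%:R) * G)); last by rewrite HG0 mulr0.
  have lSk : l.+1%:R = k%:R + j%:R + 2 :> K by rewrite -addn1 natrD lk; ring.
  by rewrite /a /b lSk; ring.
(* Coefficient of [v^l]: with [- lam = a - l], the two contributions add up to
   [a (b - lam) gbinom (a - 1) l], and [b - lam = mu - l]. *)
rewrite /bump /= !add1n add0n !subnn subSnn !gbinom0 /= scalerA -scalerDl; congr (_ *: _).
transitivity (p l * (1 - 1 - lam) + l.+1%:R * p l.+1 * (- lam)); first by ring.
rewrite pS /p subSnn subnn gbinom0.
have b1 : gbinom b 1 = b by have := gbinom_absorb b 0; rewrite gbinom0 mul1r mulr1.
have ga : gbinom a l * - lam = a * gbinom (a - 1) l.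
  by rewrite -gbinom_absorb gbinomS mulrC; congr (_ * _); rewrite /a; ring.
transitivity (b * (gbinom a l * - lam) - lam * (a * gbinom (a - 1) l)).
  by rewrite b1; ring.
by rewrite ga /b; ring.
Qed.

End JacobiShift.

Theorem theorem2p9 (R : realType) (lam mu : R[i]) (l : nat)
    (hlam : forall n : nat, lam <> n%:R) (hmu : forall n : nat, mu <> n%:R) :
  let P : {poly R[i]} :=
    jacobi l%:Z (- lam - 1) (mu + lam - 2 * l%:R + 1) \Po (2 *: 'X + 1) in
  let P' : {poly R[i]} :=
    jacobi (l%:Z - 1) (- lam - 1) (mu + lam - 2 * l%:R + 3) \Po (2 *: 'X + 1) in
  [/\ dpiX l%:Z lam mu P = 0,
      dpiF l%:Z lam mu P = (2 * (l%:R - 1 - lam) * (mu - l%:R + 1)) *: P'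
    & dpiX (l%:Z - 1) lam mu P' = 0].
Proof.
have PE n : jacobi n%:Z (- lam - 1) (mu + lam - 2 * n%:R + 1) \Po (2 *: 'X + 1)
    = jacobi_shift _ n (n%:R - 1 - lam) (mu + lam - n%:R + 1).
  by rewrite jacobi_comp; congr (jacobi_shift _ n _ _); ring.
move=> P P'; rewrite {}/P {}/P' PE dpiF_dpiX dpiX_jacobi_shift subr0.
case: l => [|l].
  (* For [l = 0] the index [-1] falls in the [Negz] branch, and [lower] kills the constant [P]. *)
  rewrite [jacobi (0%:Z - 1) _ _]/(0 : {poly _}) comp_poly0 scaler0.
  split=> //; last by rewrite /dpiX derivnS derivn1 !linear0 !mulr0 !addr0.
  rewrite /jacobi_shift lower_linear big_ord_recr big_ord0 /= add0r.
  by rewrite lower_mono !mul0r !scale0r !addr0 !scaler0.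
have -> : l.+1%:Z - 1 = l%:Z by rewrite intS addrC addKr.
(* Thus [P'] is the polynomial of the first claim for the preceding degree, which also gives the
   third claim. *)
have -> : mu + lam - 2 * l.+1%:R + 3 = mu + lam - 2 * l%:R + 1 by ring.
rewrite PE dpiX_jacobi_shift lower_jacobi_shift scalerA; split=> //.
by congr (_ *: _); ring.
Qed.
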